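(* Let $C$ and $B$ be the universal constants described in the context (for instance $C=24$ and $B=8e^2$). Let $n\ge 1$ and let $M\in\mathbb{R}^{n\times n}$ be a (symmetric) positive semidefinite and doubly stochastic matrix, with eigenvalues $1=\lambda_1\ge\lambda_2\ge\cdots\ge\lambda_n\ge 0$. Then $$\frac{n^n}{n!}\mathrm{Perm}(M)-1\le \sum_{k=2}^n\min\left\{C\sum_{\substack{k_2,\dots,k_n\ge 0\\ k_2+\cdots+k_n=k}}\lambda_2^{k_2}\cdots\lambda_n^{k_n},\ \ B^k\left(\lambda_2^2+\cdots+\lambda_n^2\right)^{k/2}\right\}.$$
   Context: $\mathrm{Perm}(D)=\sum_{\pi\in S_m}\prod_{i=1}^m D_{i,\pi(i)}$ is the permanent of an $m\times m$ matrix $D$. The inner sum ranges over tuples of nonnegative integers $(k_2,\dots,k_n)$, with the convention $0^0=1$. Constant $C$: a universal constant $C>0$ such that for all $n\ge1$, $0\le k\le n$ and $z\in\mathbb{C}^n$ with $\sum_i z_i=0$ and $\sum_i|z_i|^2=n$ one has $|e_k(z)|\le\sqrt{C\binom{n}{k}}$, where $e_k(z)=\sum_{S\subseteq\{1,\dots,n\},|S|=k}\prod_{i\in S}z_i$; the value $C=24$ is admissible. Constant $B$: a universal constant $B>0$ such that for all $n\ge1$, $1\le k\le n$ and $A\in\mathbb{C}^{n\times n}$ with all row and column sums zero and Frobenius norm $\|A\|_{\mathrm{F}}=n$ one has $|e_k(A)|\le B^k\binom{n}{k}$, where $e_k(A)=\frac{1}{k!}\sum_{S,T\subseteq\{1,\dots,n\},|S|=|T|=k}\mathrm{Perm}(A_{S,T})$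 and $A_{S,T}$ is the submatrix with rows in $S$ and columns in $T$; the value $B=8e^2$ is admissible ($e$ is Euler's number). *)

(* Defs.v *)
From mathcomp Require Import all_boot all_order all_algebra all_fingroup.
From mathcomp Require Import complex.
From mathcomp Require Import reals exp.

Set Implicit Arguments.
Unset Strict Implicit.
Unset Printing Implicit Defensive.

Import Order.TTheory GRing.Theory Num.Theory.
Local Open Scope ring_scope.
Local Open Scope complex_scope.

Definition Perm (R : comRingType) (m : nat) (D : 'M[R]_m) : R :=
  \sum_(s : 'S_m) \prod_(i < m) D i (s i).

Definition ksubset (n k : nat) := {S : {set 'I_n} | #|S| == k}.

(* The i-th smallest element of S. *)
Definition kelem (n k : nat) (S : ksubset n k) (i : 'I_k) : 'I_n :=
  enum_val (cast_ord (esym (eqP (valP S))) i).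

Definition submx_of (R : Type) (n k : nat) (A : 'M[R]_n) (S T : ksubset n k) :
  'M[R]_k := mxsub (kelem S) (kelem T) A.

Definition vec_e (R : comRingType) (n k : nat) (z : 'rV[R]_n) : R :=
  \sum_(S : {set 'I_n} | #|S| == k) \prod_(i in S) z 0 i.

Definition mx_e (F : fieldType) (n k : nat) (A : 'M[F]_n) : F :=
  (k`!%:R)^-1 *
  \sum_(S : ksubset n k)
    \sum_(T : ksubset n k) Perm (submx_of A S T).

Definition frobenius_norm (F : numClosedFieldType) (n : nat) (A : 'M[F]_n) : F :=
  sqrtC (\sum_i \sum_j `|A i j| ^+ 2).

(* In R[i], a <= b means that b - a is a nonnegative real, and the modulus
   `|z| is itself an element of R[i]; both bounds below are thus comparisons
   of real numbers embedded in R[i] by %:C. *)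
Definition vec_e_const (R : realType) (C : R) : Prop :=
  0 < C /\
  forall (n k : nat) (z : 'rV[R[i]]_n), (1 <= n)%N -> (k <= n)%N ->
    \sum_i z 0 i = 0 -> \sum_i `|z 0 i| ^+ 2 = n%:R ->
    `|vec_e k z| <= (Num.sqrt (C * 'C(n, k)%:R))%:C.

Definition mx_e_const (R : realType) (B : R) : Prop :=
  0 < B /\
  forall (n k : nat) (A : 'M[R[i]]_n), (1 <= n)%N -> (1 <= k <= n)%N ->
    (forall i, \sum_j A i j = 0) -> (forall j, \sum_i A i j = 0) ->
    frobenius_norm A = n%:R ->
    `|mx_e k A| <= (B ^+ k * 'C(n, k)%:R)%:C.

Definition psdmx (R : realType) (n : nat) (M : 'M[R]_n) : Prop :=
  M^T = M /\ forall x : 'cV[R]_n, 0 <= (x^T *m M *m x) 0 0.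

Definition doubly_stochastic (R : realType) (n : nat) (M : 'M[R]_n) : Prop :=
  [/\ forall i j, 0 <= M i j,
      forall i, \sum_j M i j = 1
    & forall j, \sum_i M i j = 1].

(* The eigenvalues of M in nonincreasing order, repeated according to their
   algebraic multiplicity. *)
Definition spectrum (R : realType) (n : nat) (M : 'M[R]_n) (lam : n.-tuple R) :
  Prop :=
  sorted >=%R lam /\ char_poly M = \prod_(x <- lam) ('X - x%:P).

(* Sum of all monomials of degree k in x_0, ..., x_(m-1); exponents of such a
   monomial are at most k, so they can be taken in 'I_k.+1. *)
Definition complete_sym (R : comRingType) (m k : nat) (x : m.-tuple R) : R :=
  \sum_(f : {ffun 'I_m -> 'I_k.+1} | (\sum_i f i)%N == k)
    \prod_(i < m) tnth x i ^+ f i.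

(* Main.v *)
From mathcomp Require Import all_boot all_order all_algebra.
From mathcomp Require Import fingroup perm action cyclic separable cyclotomic.
From mathcomp Require Import complex polyrcf.
From mathcomp Require Import reals exp ring lra.
Require Import Defs.

Set Implicit Arguments.
Unset Strict Implicit.
Unset Printing Implicit Defensive.

Import Order.TTheory GRing.Theory Num.Theory.

(** Let A = M - J/n, where J is the all-ones matrix, and let mu_2, ..., mu_n be
the eigenvalues of M after the first. Expanding the permanent of A + J/n entry
by entry, and counting the permutations that extend a given partial matching,
gives
   n^n/n! Perm(M) = sum_k n^k/binom(n,k) e_k(A)
(Perm_add_const). The term k = 0 is 1 and the term k = 1 vanishes because the
rows of A sum to zero (Perm_deflated); it remains to bound each term with
k >= 2 by both members of the minimum (deflated_bounds).

Since M fixes the all-ones vector, subtracting J/n replaces one eigenvalue 1 of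
M by 0 and keeps the others (char_poly_deflate). The spectral theorem then
yields a factorisation A = V V^* with V^* V = diag(mu) (gram_deflated).

The bound by B is homogeneity: A has zero row and column sums, and its squared
Frobenius norm is tr((V^* V)^2) = sum_j mu_j^2.

For the bound by C, let g be a vector of independent standard complex Gaussian
variables. Wick's formula turns the sum of the permanents of the k x k
submatrices of V V^* into a second moment:
   k! e_k(A) = E |e_k(V g)|^2.
The coordinates of V g sum to zero and |V g|^2 = sum_j mu_j |g_j|^2, so the
property of C bounds this by C binom(n,k)/n^k E (sum_j mu_j |g_j|^2)^k, and
since |g_j|^2 is exponentially distributed, the last expectation is k! times
the complete symmetric polynomial of degree k in mu (fischer_bound).

Only polynomials in g and its conjugate are integrated, so the expectation is
the linear functional that sends g^a conj(g)^b to a! if a = b and to 0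
otherwise, and the argument needs of it only that it is nonnegative on
nonnegative polynomials (gaussian_ge0). In one variable, averaging over the
phase of g leaves a polynomial in t = |g|^2 (gaussian1_ge0), and the
nonnegativity of the integral of p(t) exp(-t) over the half-line is a statement
about the polynomial solution q of q - q' = p (laguerre_ge0). *)

(** * Counting permutations by the fibers of a labelling *)

Definition fiber_size (T J : finType) (f : T -> J) (j : J) : nat :=
  #|[set i | f i == j]|.

(** A permutation preserving a labelling is the same thing as a family of
permutations, one of each fiber: restrict it to the fibers, or glue them. *)
Lemma card_fiber_perms (T J : finType) (f : T -> J) :
  #|[set s : {perm T} | [forall i, f (s i) == f i]]| =
    \prod_j (fiber_size f j)`!.
Proof.
pose F j := [set i | f i == j].
pose Fam := family (fun j => [pred s : {perm T} | perm_on (F j) s]).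
have on_F (h : {ffun J -> {perm T}}) j i :
    h \in Fam -> (f (h j i) == j) = (f i == j).
  move=> /familyP /(_ j); rewrite !inE => hs.
  by have := perm_closed i hs; rewrite !inE.
pose Res (s : {perm T}) : {ffun J -> {perm T}} :=
  [ffun j => restr_perm (F j) s].
pose St := [set s : {perm T} | [forall i, f (s i) == f i]].
have StN s j : s \in St -> s \in ('N(F j | 'P))%g.
  rewrite inE => /forallP hs; apply/astabsP => i /=.
  by rewrite !inE /= /aperm (eqP (hs i)).
rewrite (_ : \prod_j _ = #|Fam|); last first.
  rewrite card_family foldrE big_map big_enum /=.
  by apply: eq_bigr => j _; rewrite card_perm.
rewrite -/St -(@card_in_imset _ _ Res (mem St)); last first.
  move=> s s' hs hs' /ffunP e; apply/permP => i.
  have := e (f i); rewrite !ffunE => /permP/(_ i).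
  by rewrite !restr_permE ?StN // inE.
apply: eq_card => h; apply/imsetP/idP => [[s hs ->]|hF].
  by apply/familyP => j; rewrite ffunE inE restr_perm_on.
pose glue i := h (f i) i.
have glueE i : f (glue i) = f i by apply/eqP; rewrite /glue on_F.
have glue_inj : injective glue.
  move=> i i' e; have ff : f i = f i' by rewrite -glueE e glueE.
  by move: e; rewrite /glue ff => /perm_inj.
have gSt : perm glue_inj \in St.
  by rewrite inE; apply/forallP => i; rewrite permE glueE.
exists (perm glue_inj) => //; apply/ffunP => j; apply/permP => i; rewrite ffunE.
have [iF|iF] := boolP (i \in F j).
  by rewrite restr_permE ?StN // permE /glue; move: iF; rewrite inE => /eqP ->.
rewrite (out_perm (restr_perm_on _ _) iF).
by move/familyP: hF => /(_ j); rewrite inE => /out_perm ->.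
Qed.

Lemma eq_fiber_size_perm (k : nat) (J : finType) (f f' : 'I_k -> J) :
  fiber_size f =1 fiber_size f' -> exists s : 'S_k, forall i, f' (s i) = f i.
Proof.
move=> e.
have cnt (g : 'I_k -> J) j : count_mem j [tuple g i | i < k] = fiber_size g j.
  rewrite /fiber_size -sum1_card -sum1_count /= big_map big_enum_cond.
  by apply: eq_bigl => i; rewrite !inE.
have /tuple_permP[s /val_inj hs] :
  perm_eq [tuple f i | i < k] [tuple f' i | i < k].
  by apply/allP => j _; apply/eqP; rewrite !cnt e.
exists s => i; have := congr1 (fun t => tnth t i) hs.
by rewrite !tnth_mktuple.
Qed.

Lemma fiber_size_perm (k : nat) (J : finType) (f : 'I_k -> J) (s : 'S_k) :
  fiber_size (f \o s) =1 fiber_size f.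
Proof.
move=> j; rewrite /fiber_size -[RHS](card_preimset _ (@perm_inj _ s)).
by apply: eq_card => i; rewrite !inE.
Qed.

(** Two labellings with the same fiber sizes differ by a permutation, so the
set counted here is either empty or a translate of the stabiliser of f'. This
is Wick's formula: the right-hand side is the Gaussian moment of the monomial
attached to f times the conjugate of the one attached to f'. *)
Lemma card_match (k : nat) (J : finType) (f f' : 'I_k -> J) :
  #|[set s : 'S_k | [forall i, f' (s i) == f i]]| =
  \prod_j (if fiber_size f j == fiber_size f' j then (fiber_size f j)`! else 0).
Proof.
have [/'forall_eqP e|ne] := boolP [forall j, fiber_size f j == fiber_size f' j].
  have [s0 hs0] := eq_fiber_size_perm e.
  rewrite (eq_bigr (fun j => (fiber_size f' j)`!)) => [|j _];
    last by rewrite e eqxx.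
  rewrite -card_fiber_perms -(card_preimset _ (@mulgI _ s0)).
  apply: eq_card => s; rewrite !inE.
  apply/forallP/forallP => h i; apply/eqP; last by rewrite permM (eqP (h _)).
  have := h (s0^-1 i)%g; rewrite permM permKV => /eqP ->.
  by rewrite -hs0 permKV.
move: ne; rewrite negb_forall => /existsP[j jne].
rewrite (bigD1 j) //= (negPf jne) mul0n; apply: eq_card0 => s; rewrite !inE.
apply: contraNF jne => /forallP h; rewrite -(fiber_size_perm f' s); apply/eqP.
by apply: eq_card => i; rewrite !inE /= (eqP (h i)).
Qed.

Lemma prod_fiber_size (R : comPzRingType) (k : nat) (J : finType)
    (f : 'I_k -> J) (x : J -> R) :
  (\prod_i x (f i) = \prod_j x j ^+ fiber_size f j)%R.
Proof.
rewrite (partition_big f predT) //=; apply: eq_bigr => j _.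
rewrite (eq_bigr (fun _ => x j)) => [|i /eqP -> //].
by rewrite prodr_const; congr (_ ^+ _)%R; apply: eq_card => i; rewrite !inE.
Qed.

Lemma sum_fiber_size (k : nat) (J : finType) (f : 'I_k -> J) :
  \sum_j fiber_size f j = k.
Proof.
rewrite -[RHS]card_ord -sum1_card (partition_big f predT) //=.
apply: eq_bigr => j _; rewrite /fiber_size -sum1_card.
by apply: eq_bigl => i; rewrite !inE.
Qed.

Lemma fiber_size_lt (k : nat) (J : finType) (f : 'I_k -> J) j :
  fiber_size f j < k.+1.
Proof.
by rewrite ltnS -[X in _ <= X](sum_fiber_size f) (bigD1 j) //= leq_addr.
Qed.

(** The multinomial coefficient bounded by k! / prod_j al_j!. Each factor
prod_j (fiber_size f j)`! counts the permutations carrying f to a fixed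
labelling f0, and a permutation carries exactly one labelling to f0. *)
Lemma sum_fact_fiber_size_le (k : nat) (J : finType) (al : J -> nat) :
  \sum_(f : {ffun 'I_k -> J} | [forall j, fiber_size f j == al j])
     \prod_j (fiber_size f j)`! <= k`!.
Proof.
pose ok (f : {ffun 'I_k -> J}) := [forall j, fiber_size f j == al j].
have [f0 /'forall_eqP h0|none] := pickP ok; last by rewrite big_pred0.
pose m (s : 'S_k) (f : {ffun 'I_k -> J}) := [forall i, f (s i) == f0 i].
rewrite (eq_bigr (fun f => \sum_(s : 'S_k) (m s f : nat))); last first.
  move=> f /'forall_eqP h; rewrite -[RHS]big_mkcond /= sum1dep_card card_match.
  by apply: eq_bigr => j _; rewrite h0 h eqxx.
rewrite exchange_big /=; apply: (@leq_trans (\sum_(s : 'S_k) 1)); last first.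
  by rewrite sum1_card card_Sn.
apply: leq_sum => s _; rewrite -big_mkcondr sum1dep_card.
rewrite -(cards1 [ffun i => f0 (s^-1 i)%g]).
apply: subset_leq_card; apply/subsetP => f.
rewrite !inE => /andP[_ /forallP h]; apply/eqP/ffunP => i; rewrite ffunE.
by rewrite -(eqP (h _)) permKV.
Qed.

(** For x_j = mu_j the left-hand side is E (sum_j mu_j |g_j|^2)^k expanded into
monomials, with E |g_j|^(2a) = a!. *)
Lemma sum_ffun_fact_le (R : numDomainType) (k : nat) (J : finType)
    (x : J -> R) :
  (forall j, 0 <= x j)%R ->
  (\sum_(f : {ffun 'I_k -> J})
      (\prod_i x (f i)) * (\prod_j (fiber_size f j)`!)%:R <=
   k`!%:R * \sum_(al : {ffun J -> 'I_k.+1} | (\sum_j al j)%N == k)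
               \prod_j x j ^+ al j)%R.
Proof.
move=> x0; pose ty (f : {ffun 'I_k -> J}) : {ffun J -> 'I_k.+1} :=
  [ffun j => Ordinal (fiber_size_lt f j)].
rewrite (partition_big ty (fun al => (\sum_j al j)%N == k)) => [|f _];
  last first.
  rewrite -[X in _ == X](sum_fiber_size f); apply/eqP.
  by apply: eq_bigr => j _; rewrite ffunE.
rewrite mulr_sumr; apply: ler_sum => al _.
rewrite (eq_bigr (fun f : {ffun 'I_k -> J} =>
    (\prod_j x j ^+ al j) * (\prod_j (fiber_size f j)`!)%:R)%R).
  rewrite -mulr_sumr mulrC ler_wpM2r ?prodr_ge0 // => [j _|].
    by rewrite exprn_ge0.
  rewrite -natr_sum ler_nat.
  rewrite (eq_bigl (fun f : {ffun 'I_k -> J} =>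
    [forall j, fiber_size f j == al j])) ?sum_fact_fiber_size_le // => f.
  apply/eqP/'forall_eqP => [<- j|h]; first by rewrite ffunE.
  by apply/ffunP => j; apply: val_inj; rewrite ffunE /= h.
move=> f /eqP <-; congr (_ * _)%R; rewrite prod_fiber_size.
by apply: eq_bigr => j _; rewrite ffunE.
Qed.

Local Open Scope ring_scope.
Local Open Scope sesquilinear_scope.

(** * Positivity of the Laguerre functional *)

Lemma derivn_sum_eq (R : comNzRingType) (p : {poly R}) :
  let q := \sum_(m < size p) p^`(m) in q - q^`() = p.
Proof.
move=> q; rewrite /q linear_sum /=.
under [X in _ - X]eq_bigr do rewrite -derivnS.
have := telescope_sumr (fun m => p^`(m)) (leq0n (size p)).
rewrite derivn_poly0 // derivn0 sub0r => h.
rewrite -sumrB -[RHS]opprK -h big_mkord -sumrN.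
by apply: eq_bigr => i _; rewrite opprB.
Qed.

(** The sum is the integral of p(x) exp(-x) over the half-line, which is q(0)
for q the sum of all derivatives of p, because (q exp(-x))' = - p exp(-x). If
q(0) were negative, then q, whose leading term is that of p, would have a first
root c > 0; on the interval from 0 to c one has q' = q - p <= q < 0, which
prevents q from increasing from q(0) to 0. *)
Lemma laguerre_ge0 (R : rcfType) (p : {poly R}) :
  (forall x, 0 <= x -> 0 <= p.[x]) -> 0 <= \sum_(i < size p) i`!%:R * p`_i.
Proof.
move=> p_ge0.
have [->|p0] := eqVneq p 0; first by rewrite size_poly0 big_ord0.
pose q := \sum_(m < size p) p^`(m).
have qE : q^`() = q - p by rewrite -(derivn_sum_eq p) -/q; ring.
have -> : \sum_(i < size p) i`!%:R * p`_i = q.[0].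
  rewrite /q horner_sum; apply: eq_bigr => i _.
  by rewrite horner_coef0 coef_derivn addn0 ffactnn mulr_natl.
rewrite leNgt; apply/negP => q0_lt0.
have sz_q : (size (q - p)%R < size p)%N.
  have lt_p : (size p^`() < size p)%N := lt_size_deriv p0.
  apply: leq_ltn_trans lt_p; rewrite -qE linear_sum /=.
  apply: (leq_trans (size_sum _ _ _)); apply/bigmax_leqP => i _.
  rewrite -derivnS derivSn; elim: (i : nat) => [|j IH];
    first by rewrite derivn0.
  rewrite derivnS; apply: leq_trans IH.
  by have [->|/lt_size_deriv/ltnW//] := eqVneq (p^`()^`(j)) 0; rewrite linear0.
have q_lead : lead_coef q = lead_coef p.
  by rewrite -[q](subrK p) addrC lead_coefDl.
have p_lead : 0 < lead_coef p.
  have [||] := ltrgtP 0 (lead_coef p) => //.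
    move=> lt0; have lcN : 0 < lead_coef (- p) by rewrite lead_coefN oppr_gt0.
    have [b hb] := poly_pinfty_gt_lc lcN.
    have := hb (Num.max b 0); rewrite le_max lexx => /(_ isT).
    rewrite lead_coefN hornerN lerN2 => /le_lt_trans/(_ lt0).
    by rewrite ltNge p_ge0 // le_max lexx orbT.
  by move/esym/eqP; rewrite lead_coef_eq0 (negPf p0).
have lcq : 0 < lead_coef q by rewrite q_lead.
have [b hb] := poly_pinfty_gt_lc lcq.
pose b' := Num.max b 1.
have qb_gt0 : 0 < q.[b'].
  by apply: lt_le_trans (hb _ _); rewrite ?q_lead // le_max lexx.
have b'_gt0 : 0 < b' by rewrite lt_max ltr01 orbT.
have q_n0 : q != 0 by apply: contraTneq q0_lt0 => ->; rewrite horner0 ltxx.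
pose c := next_root q 0 b'.
have noroot_c := @next_noroot _ q 0 b'.
have cP : 0 < c /\ q.[c] = 0.
  have := @next_root_gt _ q 0 b' b'_gt0 q_n0; rewrite -/c => c0.
  split => //; rewrite /c; case: next_rootP => //=.
  - by move/eqP; rewrite (negPf q_n0).
  - move=> c' _ c'E hno.
    have sgq : q.[0] * q.[b'] < 0 by rewrite nmulr_rlt0.
    have [x xI /rootP x0] := poly_ivtoo (ltW b'_gt0) sgq.
    move: c'E; rewrite max_l ?ltW // => c'E.
    by move: (hno x); rewrite c'E xI => /(_ isT); rewrite /root x0 eqxx.
have [c_gt0 qc0] := cP.
have q_lt0 x : 0 <= x -> x < c -> q.[x] < 0.
  move=> x0 xc; rewrite ltNge; apply/negP => qx.
  have [y yI /rootP y0] : exists2 y, y \in `]0, c[ & root q y.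
    have [x_eq0|xn0] := eqVneq x 0.
      by move: qx; rewrite x_eq0 leNgt q0_lt0.
    have x_gt0 : 0 < x by rewrite lt_neqAle eq_sym xn0.
    have sgq : q.[0] <= 0 <= q.[x] by rewrite qx ltW.
    have [y yI yr] := poly_ivt x0 sgq.
    exists y => //; move: yI; rewrite !in_itv /= => /andP[y0 yx].
    rewrite (le_lt_trans yx xc) andbT lt_neqAle y0 andbT.
    by apply: contraTneq yr => <-; rewrite /root lt_eqF.
  by move: (noroot_c y yI); rewrite /root y0 eqxx.
have [d dI] := poly_mvt q c_gt0.
rewrite qc0 sub0r subr0 qE => dE.
move: dI; rewrite in_itv /= => /andP[d0 dc].
have h1 : (q - p).[d] < 0.
  rewrite hornerD hornerN.
  by have := q_lt0 d (ltW d0) dc; have := p_ge0 d (ltW d0); lra.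
have : (q - p).[d] * c < 0 by rewrite pmulr_llt0.
by rewrite -dE; lra.
Qed.

(** * Positivity of the complex Gaussian functional *)

Lemma prim_root_exists (C : numClosedFieldType) n :
  (n > 0)%N -> exists z : C, n.-primitive_root z.
Proof.
move=> n_gt0; have [r] := closed_field_poly_normal ('X^n - 1 : {poly C}).
rewrite (monicP _) ?monicXnsubC // scale1r => rE.
have r_unity : all n.-unity_root r.
  by apply/allP => z zr; rewrite /root_of_unity rE root_prod_XsubC.
have r_uniq : uniq r.
  by rewrite -separable_prod_XsubC -rE separable_Xn_sub_1 // pnatr_eq0 -lt0n.
have r_size : (n <= size r)%N.
  by rewrite -ltnS -(size_prod_XsubC r id) -rE size_XnsubC.
by have /hasP[z _ zP] := has_prim_root n_gt0 r_unity r_uniq r_size; exists z.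
Qed.

(** Orthogonality of the characters of the N-th roots of unity. *)
Lemma sum_prim_root (C : numClosedFieldType) N (z : C) (a b : nat) :
  N.-primitive_root z -> (a < N)%N -> (b < N)%N ->
  \sum_(d < N) ((z ^+ d) ^+ a * ((z ^+ d)^*) ^+ b) =
  (if a == b then N else 0%N)%:R.
Proof.
move=> zP aN bN; have z0 : z != 0.
  have N0 : (0 < N)%N by apply: leq_ltn_trans aN.
  apply: contra_eq_neq (prim_expr_order zP) => ->.
  by rewrite expr0n gtn_eqF // eq_sym oner_eq0.
have zc : z^* = z^-1.
  have /eqP : `|z| ^+ N = 1 by rewrite -normrX (prim_expr_order zP) normr1.
  rewrite pexpr_eq1 ?normr_ge0 //; last exact: leq_ltn_trans aN.
  by move=> /eqP z1; rewrite invC_norm z1 expr1n invr1 mul1r.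
pose x := z ^+ a / z ^+ b.
rewrite (eq_bigr (fun d : 'I_N => x ^+ d)) => [|d _]; last first.
  rewrite rmorphXn /= zc /x exprMn !exprVn -!exprM.
  by rewrite [(d * a)%N]mulnC [(d * b)%N]mulnC.
have [ab|ab] := eqVneq a b.
  rewrite /x ab divff ?expf_neq0 //.
  by under eq_bigr do rewrite expr1n; rewrite sumr_const card_ord.
have x1 : x - 1 != 0.
  rewrite subr_eq0; apply: contra ab => /eqP x1.
  have /eqP : z ^+ a = z ^+ b.
    by rewrite -[LHS](divfK (expf_neq0 b z0)) -/x x1 mul1r.
  by rewrite (eq_prim_root_expr zP) !modn_small.
apply: (mulfI x1); rewrite -subrX1 mulr0 /x exprMn exprVn -!exprM
  [(a * N)%N]mulnC.
by rewrite [(b * N)%N]mulnC !exprM (prim_expr_order zP) !expr1n divr1 subrr.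
Qed.

Lemma Re_sum (R : rcfType) (I : Type) (r : seq I) (P : pred I) (F : I -> R[i]) :
  complex.Re (\sum_(i <- r | P i) F i) = \sum_(i <- r | P i) complex.Re (F i).
Proof. by apply: big_morph => // -[? ?] [? ?]. Qed.

Lemma Re_mulr_real (R : rcfType) (z : R[i]) (x : R) :
  complex.Re (z * x%:C%C) = complex.Re z * x.
Proof. by case: z => u v /=; rewrite mulr0 subr0. Qed.

(** Averaging over g = sqrt t * w, with w running over roots of unity of large
order, kills the monomials with different exponents and leaves a polynomial in
t that is nonnegative on the half-line. *)
Lemma gaussian1_ge0 (R : rcfType) (I : finType) (c : I -> R[i])
    (a b : I -> nat) :
  (forall g : R[i], 0 <= complex.Re (\sum_i c i * (g ^+ a i * g^* ^+ b i))) ->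
  0 <= complex.Re (\sum_i c i * (if a i == b i then (a i)`! else 0%N)%:R).
Proof.
move=> hpos.
pose N := (\sum_i (a i + b i)).+1.
have aN i : (a i < N)%N by rewrite /N ltnS (bigD1 i) //= -addnA leq_addr.
have bN i : (b i < N)%N by rewrite /N ltnS (bigD1 i) //= addnAC leq_addl.
have [z zP] := @prim_root_exists R[i] N isT.
pose p := \sum_(i | a i == b i) (complex.Re (c i))%:P * 'X^(a i).
have p_ge0 t : 0 <= t -> 0 <= p.[t].
  move=> t0; pose s := Num.sqrt t.
  have : 0 <= \sum_(d < N) complex.Re (\sum_i c i *
     ((s%:C%C * z ^+ d) ^+ a i * (s%:C%C * z ^+ d)^* ^+ b i)).
    by apply: sumr_ge0.
  rewrite -Re_sum exchange_big /= (_ : \sum_i _ =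
    \sum_(i | a i == b i) c i * (N%:R * t ^+ a i)%:C%C); last first.
    rewrite [RHS]big_mkcond; apply: eq_bigr => i _.
    rewrite -mulr_sumr; rewrite (eq_bigr
      (fun d : 'I_N => s%:C%C ^+ (a i + b i) *
       ((z ^+ d) ^+ a i * (z ^+ d)^* ^+ b i))); last first.
      move=> d _; rewrite rmorphM /= exprMn [X in _ * X]exprMn.
      rewrite (_ : (s%:C%C)^* = s%:C%C); last exact: (conjc_real s).
      by rewrite exprD; ring.
    rewrite -mulr_sumr (sum_prim_root zP) //; case: eqP => [ab|];
      last by rewrite !mulr0.
    congr (_ * _); rewrite rmorphM rmorph_nat mulrC /=; congr (_ * _).
    by rewrite -ab addnn -mul2n exprM -!(rmorphXn (real_complex R)) sqr_sqrtr.
  rewrite Re_sum (eq_bigr (fun i => N%:R * (complex.Re (c i) * t ^+ a i))).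
    rewrite -mulr_sumr pmulr_rge0 ?ltr0n // => h; rewrite /p horner_sum.
    by under eq_bigr do rewrite hornerM hornerC hornerXn.
  by move=> i _; rewrite Re_mulr_real; ring.
have := laguerre_ge0 p_ge0.
have szp : (size p <= N)%N.
  apply: (leq_trans (size_sum _ _ _)); apply/bigmax_leqP => i _.
  by rewrite mul_polyC (leq_trans (size_scale_leq _ _)) // size_polyXn.
have -> : \sum_(i < size p) i`!%:R * p`_i = \sum_(i < N) i`!%:R * p`_i.
  rewrite (big_ord_widen_cond N xpredT (fun i => i`!%:R * p`_i) szp) big_mkcond.
  apply: eq_bigr => i _; case: ifP => //= /negbT; rewrite -leqNgt => h.
  by rewrite nth_default // mulr0.
rewrite Re_sum; congr (_ <= _).
under eq_bigr do rewrite /p coef_sum mulr_sumr.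
rewrite exchange_big /= big_mkcond; apply: eq_bigr => i _.
case: eqP => [ab|_]; last by rewrite mulr0.
rewrite (bigD1 (Ordinal (aN i))) //= coefCM coefXn eqxx mulr1 big1 ?addr0.
  by rewrite -(rmorph_nat (real_complex R)) Re_mulr_real mulrC.
move=> j ja; rewrite coefCM coefXn; case: eqP => [E|_]; last by rewrite !mulr0.
by case/eqP: ja; apply: val_inj.
Qed.

(** The variables are integrated out one at a time, the others staying fixed.
*)
Lemma gaussian_ge0 (R : rcfType) (I J : finType) (c : I -> R[i])
    (a b : I -> J -> nat) :
  (forall g : J -> R[i], 0 <=
     complex.Re (\sum_i c i * \prod_j (g j ^+ a i j * (g j)^* ^+ b i j))) ->
  0 <= complex.Re (\sum_i c i *
     \prod_j (if a i j == b i j then (a i j)`! else 0%N)%:R).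
Proof.
move=> hpos.
pose fac i j : R[i] := (if a i j == b i j then (a i j)`! else 0%N)%:R.
pose mon (g : J -> R[i]) i j := g j ^+ a i j * (g j)^* ^+ b i j.
(* the variables in s have been integrated out *)
suff H (s : seq J) : uniq s -> forall g : J -> R[i],
    0 <= complex.Re (\sum_i c i * \prod_j
      (if j \in s then fac i j else mon g i j)).
  have := H (enum J) (enum_uniq _) (fun=> 0).
  by under eq_bigr do under eq_bigr do rewrite mem_enum.
elim: s => [_ g|k s IH /= /andP[ks us] g]; first exact: hpos.
pose d i := c i * \prod_(j | j != k) (if j \in s then fac i j else mon g i j).
have := @gaussian1_ge0 R I d (a^~ k) (b^~ k); rewrite /=.
have -> : \sum_i d i * (if a i k == b i k then (a i k)`! else 0)%:R =
  \sum_i c i * \prod_j (if j \in k :: s then fac i j else mon g i j).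
  apply: eq_bigr => i _; rewrite [in RHS](bigD1 k) //= inE eqxx /= /d -mulrA;
    congr (_ * _).
  rewrite mulrC; congr (_ * _); apply: eq_bigr => j jk.
  by rewrite inE (negPf jk).
apply=> x; have := IH us (fun j => if j == k then x else g j).
congr (_ <= complex.Re _); apply: eq_bigr => i _.
rewrite (bigD1 k) //= (negPf ks) {1}/mon eqxx /d -mulrA; congr (_ * _).
rewrite mulrC; congr (_ * _); apply: eq_bigr => j jk.
by rewrite /mon (negPf jk).
Qed.

(** * Wick expansion of the permanents of a Gram matrix *)

Lemma kelem_inj n k (S : ksubset n k) : injective (kelem S).
Proof. by move=> i j /enum_val_inj /cast_ord_inj. Qed.

Lemma kelemP n k (S : ksubset n k) i :
    reflect (exists j, i = kelem S j) (i \in val S).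
Proof.
apply: (iffP idP) => [iS|[j ->]]; last exact: enum_valP.
exists (cast_ord (eqP (valP S)) (enum_rank_in iS i)).
by rewrite /kelem cast_ordK enum_rankK_in.
Qed.

(** The increasing enumeration of S turns a product over S into one indexed by
'I_k, the form in which the entries of submatrices appear. *)
Lemma prod_kelem (R : comPzRingType) n k (S : ksubset n k) (F : 'I_n -> R) :
  \prod_(i in val S) F i = \prod_(i < k) F (kelem S i).
Proof.
rewrite -(big_imset _ (h := kelem S) (A := predT)) /=; last by move=> i j _ _;
  apply: kelem_inj.
apply: eq_bigl => i; apply/kelemP/imsetP => [[j ->]|[j _ ->]]; by exists j.
Qed.

Lemma sum_ksubset (R : nmodType) n k (F : {set 'I_n} -> R) :
  \sum_(S : {set 'I_n} | #|S| == k) F S = \sum_(S : ksubset n k) F (val S).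
Proof.
rewrite (reindex_omap (val : ksubset n k -> _) insub) => [|S hS];
  last by rewrite insubT.
by apply: eq_bigl => S; rewrite valK eqxx andbT (valP S).
Qed.

(** The sum of the coefficients with which the words g_(f 0) ... g_(f (k-1))
arise in e_k(V g) when each factor (V g)_i is expanded. Words that agree up to
order are kept apart, which avoids choosing representatives. *)
Definition gram_coef (C : numClosedFieldType) (n m k : nat) (V : 'M[C]_(n, m))
    (f : {ffun 'I_k -> 'I_m}) : C :=
  \sum_(S : ksubset n k) \prod_i V (kelem S i) (f i).

Lemma vec_e_expand (C : numClosedFieldType) (n m k : nat) (V : 'M[C]_(n, m))
    (g : 'cV[C]_m) :
  vec_e k (V *m g)^T =
  \sum_(f : {ffun 'I_k -> 'I_m}) gram_coef V f * \prod_i g (f i) 0.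
Proof.
rewrite /vec_e sum_ksubset.
under eq_bigr do rewrite prod_kelem;
  under eq_bigr do under eq_bigr do rewrite !mxE.
under eq_bigr do rewrite bigA_distr_bigA.
rewrite exchange_big; apply: eq_bigr => f _; rewrite mulr_suml;
  apply: eq_bigr => S _.
by rewrite big_split.
Qed.

(** Expanding each entry of V V^* in the permanent pairs a word f for the rows
with the word f' for the columns obtained from f by the permutation s. *)
Lemma sum_Perm_expand (C : numClosedFieldType) (n m k : nat)
    (V : 'M[C]_(n, m)) :
  \sum_(S : ksubset n k) \sum_(T : ksubset n k) Perm
    (submx_of (V *m V^t*) S T) =
  \sum_(f : {ffun 'I_k -> 'I_m}) \sum_(f' : {ffun 'I_k -> 'I_m})
     gram_coef V f * (gram_coef V f')^* *
     (#|[set s : 'S_k | [forall i, f' (s i) == f i]]|)%:R.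
Proof.
pose FF := {ffun 'I_k -> 'I_m}.
pose term (S T : ksubset n k) (f f' : FF) :=
  (\prod_i V (kelem S i) (f i)) * (\prod_i V (kelem T i) (f' i))^*.
transitivity (\sum_(S : ksubset n k) \sum_(T : ksubset n k)
   \sum_(f : FF) \sum_(f' : FF) term S T f f' *
     (#|[set s : 'S_k | [forall i, f' (s i) == f i]]|)%:R).
  apply: eq_bigr => S _; apply: eq_bigr => T _.
  transitivity (\sum_(s : 'S_k) \sum_(f : FF)
     \sum_(f' : FF | [forall i, f' (s i) == f i]) term S T f f').
    apply: eq_bigr => s _.
    under eq_bigr do rewrite !mxE.
    rewrite bigA_distr_bigA; apply: eq_bigr => f _.
    rewrite (big_pred1 [ffun i => f (s^-1 i)%g]).
      rewrite big_split /=; congr (_ * _).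
      rewrite rmorph_prod [RHS](reindex_inj (@perm_inj _ s));
        apply: eq_bigr => i _.
      by rewrite !mxE ffunE permK.
    move=> f'; rewrite /=; apply/forallP/eqP => [h|-> i];
      last by rewrite ffunE permK.
    by apply/ffunP => i; rewrite ffunE -(eqP (h _)) permKV.
  rewrite exchange_big; apply: eq_bigr => f _.
  under eq_bigr do rewrite big_mkcond.
  rewrite exchange_big; apply: eq_bigr => f' _.
  by rewrite -big_mkcond sumr_const mulr_natr; congr (_ *+ _);
    apply: eq_card => s; rewrite !inE.
under eq_bigr do rewrite exchange_big.
rewrite exchange_big; apply: eq_bigr => f _.
under eq_bigr do rewrite exchange_big.
rewrite exchange_big; apply: eq_bigr => f' _.
under eq_bigr do rewrite -mulr_suml.
rewrite -mulr_suml; congr (_ * _).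
rewrite mulr_suml; apply: eq_bigr => S _.
by rewrite rmorph_sum mulr_sumr.
Qed.

(** The inequality between the expectations of |e_k(V g)|^2 and of K (sum_j
mu_j |g_j|^2)^k: the hypothesis says that their difference is a nonnegative
polynomial in g, and gaussian_ge0 integrates it. *)
Lemma fischer_bound (R : realType) (n m k : nat) (V : 'M[R[i]%C]_(n, m))
    (mu : 'I_m -> R) (K : R) :
  0 <= K -> (forall j, 0 <= mu j) ->
  (forall g : 'cV[R[i]%C]_m, `|vec_e k (V *m g)^T| ^+ 2 <=
     K%:C%C * (\sum_j (mu j)%:C%C * `|g j 0| ^+ 2) ^+ k) ->
  complex.Re (\sum_(S : ksubset n k) \sum_(T : ksubset n k)
     Perm (submx_of (V *m V^t*) S T)) <=
  K * (k`!%:R * \sum_(al : {ffun 'I_m -> 'I_k.+1} | (\sum_j al j)%N == k)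
                   \prod_j mu j ^+ al j).
Proof.
move=> K0 mu0 hV.
pose FF := {ffun 'I_k -> 'I_m}.
pose c (p : FF * FF) : R[i]%C :=
   (if p.1 == p.2 then (K * \prod_i mu (p.1 i))%:C%C else 0) -
   gram_coef V p.1 * (gram_coef V p.2)^*.
have := @gaussian_ge0 R _ _ c (fun p => fiber_size p.1)
  (fun p => fiber_size p.2).
have splitc (G : FF -> FF -> R[i]%C) : \sum_p c p * G p.1 p.2 =
   \sum_(f : FF) (K * \prod_i mu (f i))%:C%C * G f f -
   \sum_(f : FF) \sum_(f' : FF) gram_coef V f * (gram_coef V f')^* * G f f'.
  rewrite -(pair_bigA _ (fun f f' => c (f, f') * G f f')) /= -sumrB;
    apply: eq_bigr => f _.
  under eq_bigr do rewrite mulrBl.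
  rewrite big_split /= sumrN; congr (_ - _).
  by rewrite (bigD1 f) //= eqxx [X in _ + X]big1 ?addr0 // => f' ne;
    rewrite eq_sym (negPf ne) mul0r.
have matchE (p : FF * FF) :
    \prod_j (if fiber_size p.1 j == fiber_size p.2 j
              then (fiber_size p.1 j)`! else 0%N)%:R =
    (#|[set s : 'S_k | [forall i, p.2 (s i) == p.1 i]]|)%:R :> R[i]%C.
  by rewrite card_match natr_prod.
under [X in complex.Re X]eq_bigr do rewrite matchE.
rewrite (splitc (fun f f' => (#|[set s :
  'S_k | [forall i, f' (s i) == f i]]|)%:R)).
rewrite -sum_Perm_expand => hgauss.
have ReB (x y : R[i]%C) : complex.Re (x - y) =
  complex.Re x - complex.Re y by case: x; case: y.
apply: (@le_trans _ _ (complex.Re (\sum_(f : FF) (K * \prod_i mu (f i))%:C%C *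
   (#|[set s : 'S_k | [forall i, f (s i) == f i]]|)%:R))).
  rewrite -subr_ge0 -ReB; apply: hgauss => g.
  have monE (p : FF * FF) :
      \prod_j (g j ^+ fiber_size p.1 j * (g j)^* ^+ fiber_size p.2 j) =
      (\prod_i g (p.1 i)) * (\prod_i g (p.2 i))^*.
    rewrite big_split /= !prod_fiber_size rmorph_prod; congr (_ * _).
    by apply: eq_bigr => j _; rewrite rmorphXn.
  under eq_bigr do rewrite monE.
  rewrite (splitc (fun f f' => (\prod_i g (f i)) * (\prod_i g (f' i))^*)) ReB
    subr_ge0.
  have /= := hV (\col_j g j).
  have -> : `|vec_e k (V *m \col_j g j)^T| ^+ 2 =
      \sum_(f : FF) \sum_(f' : FF) gram_coef V f * (gram_coef V f')^* *
        (\prod_i g (f i) * (\prod_i g (f' i))^*).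
    rewrite vec_e_expand normCK rmorph_sum mulr_suml; apply: eq_bigr => f _.
    rewrite mulr_sumr; apply: eq_bigr => f' _; rewrite rmorphM /=.
    under eq_bigr do rewrite mxE; under [in X in _ * X]eq_bigr do rewrite mxE.
    ring.
  have -> : K%:C%C * (\sum_j (mu j)%:C%C * `|(\col_j g j) j 0| ^+ 2) ^+ k =
      \sum_(f : FF) (K * \prod_i mu (f i))%:C%C *
        (\prod_i g (f i) * (\prod_i g (f i))^*).
    rewrite -[in LHS](card_ord k) -prodr_const bigA_distr_bigA mulr_sumr;
      apply: eq_bigr => f _.
    rewrite big_split /= rmorphM rmorph_prod -mulrA; congr (_ * (_ * _)).
    rewrite rmorph_prod -big_split; apply: eq_bigr => i _.
    by rewrite mxE normCK.
  by rewrite lecE => /andP[].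
rewrite Re_sum mulrCA.
rewrite (eq_bigr (fun f : FF => K *
  (\prod_i mu (f i) * (\prod_j (fiber_size f j)`!)%:R))) => [|f _].
  rewrite -mulr_sumr mulrCA ler_wpM2l //.
  exact: sum_ffun_fact_le.
rewrite -(rmorph_nat (real_complex R)) Re_mulr_real -mulrA;
  congr (_ * (_ * _%:R)).
by rewrite card_match; apply: eq_bigr => j _; rewrite eqxx.
Qed.

(** * Permanent of a matrix shifted by a constant *)

Lemma fiber_size_inj (k : nat) (J : finType) (f : 'I_k -> J) j :
  injective f -> fiber_size f j = [exists i, f i == j].
Proof.
move=> fI; case: existsP => [[i /eqP <-]|h]; last first.
  by apply: eq_card0 => i; rewrite !inE; apply/negP => e; apply: h; exists i.
by rewrite /fiber_size -[RHS](cards1 i); apply: eq_card => i';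
  rewrite !inE inj_eq.
Qed.

Lemma big_option (R : Type) (idx : R) (op : Monoid.com_law idx) (J : finType)
    (F : option J -> R) :
  \big[op/idx]_o F o = op (F None) (\big[op/idx]_j F (Some j)).
Proof.
rewrite (bigD1 None) //=; congr (op _ _).
by rewrite (reindex_omap Some id) => [|[]//]; apply: eq_bigl => j /=;
  rewrite eqxx.
Qed.

(** Label the point f j, respectively g j, by Some j and every other point by
None. A permutation extends the partial matching exactly when it matches the
two labellings, whose fibers have size 1 except the one of None. *)
Lemma card_perm_extending (n k : nat) (f g : 'I_k -> 'I_n) :
  injective f -> injective g ->
  #|[set s : 'S_n | [forall i, s (f i) == g i]]| = (n - k)`!.
Proof.
move=> fI gI.
pose lab (h : 'I_k -> 'I_n) i := [pick j | h j == i].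
have labE h j : injective h -> lab h (h j) = Some j.
  move=> hI; rewrite /lab; case: pickP => [j' /eqP/hI ->//|/(_ j)];
    by rewrite eqxx.
have labS h i j : lab h i = Some j -> h j = i.
  by rewrite /lab; case: pickP => // j' /eqP <- [<-].
have multS h j : injective h -> fiber_size (lab h) (Some j) = 1%N.
  move=> hI; rewrite /fiber_size -[RHS](cards1 (h j)); apply: eq_card => i;
    rewrite !inE.
  by apply/eqP/eqP => [/labS <-|->]; rewrite ?labE.
have multN h : injective h -> fiber_size (lab h) None = (n - k)%N.
  move=> hI; have := sum_fiber_size (lab h).
  rewrite big_option (eq_bigr (fun=> 1%N)) => [|j _]; last exact: multS.
  by rewrite sum1_card card_ord => e; rewrite -(addnK k (fiber_size _ _)) e.
have := card_match (lab f) (lab g).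
rewrite big_option !multN // eqxx big1 => [/=|j _]; last first.
  by rewrite !multS.
rewrite muln1 => <-; apply: eq_card => s; rewrite !inE;
  apply/forallP/forallP => h i; apply/eqP.
  case E: (lab f i) => [j|]; first by rewrite -(labS _ _ _ E) (eqP (h j)) labE.
  case E': (lab g (s i)) => [j|//].
  have := labS _ _ _ E'; rewrite -(eqP (h j)) => /perm_inj fj.
  by rewrite -fj labE in E.
by have := h (f i); rewrite labE // => /eqP/labS.
Qed.

(** The restriction of s to S determines its image T0 and, through the
increasing enumerations of S and T0, a permutation t0 of 'I_k. *)
Lemma unique_matching (n k : nat) (S : ksubset n k) (s : 'S_n) :
  exists T0 : ksubset n k, exists t0 :
    'S_k, forall (T : ksubset n k) (t : 'S_k),
   [forall i, s (kelem S i) == kelem T (t i)] = ((T, t) == (T0, t0)).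
Proof.
have T0P : #|s @: val S| == k by rewrite card_imset ?(valP S) //;
  apply: perm_inj.
pose T0 : ksubset n k := Sub (s @: val S) T0P.
have sSI : injective (fun i => s (kelem S i)) by move=> i j /perm_inj
  /kelem_inj.
have [t0 ht0] : exists t0 : 'S_k, forall i, kelem T0 (t0 i) = s (kelem S i).
  apply: eq_fiber_size_perm => j; rewrite !fiber_size_inj //;
    last exact: kelem_inj.
  congr nat_of_bool; apply/existsP/existsP => [[i /eqP <-]|[i /eqP <-]].
    have /kelemP[i' ->] : s (kelem S i) \in val T0.
      by rewrite imset_f //; apply/kelemP; exists i.
    by exists i'.
  have /imsetP[x /kelemP[i' ->] ->] : kelem T0 i \in s @: val S.
    by apply/(kelemP T0); exists i.
  by exists i'.
exists T0, t0 => T t; apply/forallP/eqP => [h|[-> ->] i]; last by rewrite ht0.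
have TE : T = T0.
  apply: val_inj; apply/setP => x /=;
    apply/kelemP/imsetP => [[i ->]|[y /kelemP[i ->] ->]].
    exists (kelem S (t^-1 i)%g); first by apply/kelemP; exists (t^-1 i)%g.
    by rewrite (eqP (h _)) permKV.
  by exists (t i); apply/eqP.
rewrite TE in h *; congr (_, _); apply/permP => i.
by apply: (@kelem_inj _ _ T0); rewrite ht0 (eqP (h i)).
Qed.

(** Group the permutations s by their restriction to S: each injection of S
into the columns is a pair (T, t) and has (n - k)! extensions. *)
Lemma sum_perm_sub (R : comNzRingType) n k (A : 'M[R]_n) (S : ksubset n k) :
  \sum_(s : 'S_n) \prod_(i in val S) A i (s i) =
  ((n - k)`!)%:R * \sum_(T : ksubset n k) Perm (submx_of A S T).
Proof.
transitivity (\sum_(s : 'S_n)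
   \sum_(p : ksubset n k * 'S_k |
     [forall i, s (kelem S i) == kelem p.1 (p.2 i)])
   \prod_i A (kelem S i) (kelem p.1 (p.2 i))).
  apply: eq_bigr => s _; have [T0 [t0 h0]] := unique_matching S s.
  rewrite (big_pred1 (T0, t0)) => [|[T t]]; last by rewrite /= h0.
  rewrite prod_kelem; apply: eq_bigr => i _; congr (A _ _) => /=.
  by have := h0 T0 t0; rewrite eqxx => /forallP/(_ i)/eqP.
rewrite (exchange_big_dep predT) //= mulr_sumr /Perm.
under [RHS]eq_bigr do rewrite mulr_sumr.
rewrite pair_bigA /=; apply: eq_bigr => -[T t] _ /=.
rewrite sumr_const mulr_natl.
rewrite -(@card_perm_extending n k (kelem S) (fun i => kelem T (t i)));
  last first.
- by move=> i j /kelem_inj /perm_inj.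
- exact: kelem_inj.
congr (_ *+ _); last by apply: eq_card => s; rewrite !inE.
by apply: eq_bigr => i _; rewrite mxE.
Qed.

Lemma Perm_add_const (R : comNzRingType) n (A : 'M[R]_n) (c : R) :
  Perm (A + const_mx c) = \sum_(k < n.+1) ((n - k)`!)%:R * c ^+ (n - k) *
    \sum_(S : ksubset n k) \sum_(T : ksubset n k) Perm (submx_of A S T).
Proof.
transitivity (\sum_(S : {set 'I_n}) c ^+ (n - #|S|) *
   \sum_(s : 'S_n) \prod_(i in S) A i (s i)).
  under [RHS]eq_bigr do rewrite mulr_sumr.
  rewrite [RHS]exchange_big; apply: eq_bigr => s _.
  rewrite (eq_bigr (fun i => A i (s i) + c)) => [|i _]; last by rewrite !mxE.
  rewrite bigA_distr; apply: eq_bigr => S _.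
  rewrite (bigID (mem S)) /= mulrC; congr (_ * _).
    rewrite (eq_bigr (fun=> c)) => [|i /negPf -> //].
    rewrite prodr_const; congr (_ ^+ _).
    transitivity #|~: S|; first by apply: eq_card => i; rewrite !inE.
    by rewrite -(addKn #|S| #|~: S|) cardsC card_ord.
  by apply: eq_bigr => i ->.
rewrite (partition_big (fun S : {set 'I_n} => inord #|S| : 'I_n.+1) predT) //=.
apply: eq_bigr => k _.
have SE (S : {set 'I_n}) : (inord #|S| == k :> 'I_n.+1) = (#|S| == k).
  have Sn : (#|S| < n.+1)%N by rewrite ltnS -[X in (_ <= X)%N]card_ord max_card.
  by rewrite -(inj_eq val_inj) /= inordK.
rewrite (eq_bigl _ _ SE) sum_ksubset mulr_sumr; apply: eq_bigr => S _.
by rewrite (eqP (valP S)) sum_perm_sub mulrCA mulrA.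
Qed.

Lemma sum_Perm1_eq0 (R : comNzRingType) n (A : 'M[R]_n) :
  (forall i, \sum_j A i j = 0) ->
  \sum_(S : ksubset n 1) \sum_(T : ksubset n 1) Perm (submx_of A S T) = 0.
Proof.
move=> hA; rewrite big1 // => S _.
transitivity (\sum_(T : ksubset n 1) \prod_(i in val T) A (kelem S 0) i).
  apply: eq_bigr => T _; rewrite prod_kelem big_ord1 /Perm (big_pred1 1%g).
    by rewrite big_ord1 perm1 mxE.
  by move=> s; apply/esym/eqP/permP => i; rewrite !ord1.
rewrite -(sum_ksubset 1%N (fun T => \prod_(i in T) A (kelem S 0) i)) big_cards1.
by under eq_bigr do rewrite big_set1; apply: hA.
Qed.

(** * Spectrum of a doubly stochastic matrix and of its deflation *)

(** Both sides are the determinant of the product of the block matrices [1, v;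
u, X] and [X, 0; -u, 1], computed before and after multiplying. The factor 'X
makes the identity hold also for n = 0. *)
Lemma char_poly_rank1 (R : idomainType) n (u : 'cV[R]_n) (v : 'rV[R]_n) :
  'X * char_poly (u *m v) = ('X - ((v *m u) 0 0)%:P) * 'X^n.
Proof.
pose U := map_mx polyC u; pose W := map_mx polyC v.
pose B := block_mx 1%:M W U ('X%:M).
have L : B = block_mx 1%:M 0 U 1%:M *m block_mx 1%:M W 0
  (char_poly_mx (u *m v)).
  rewrite mulmx_block !mul1mx !mul0mx !mulmx1 !addr0 /char_poly_mx map_mxM.
  by rewrite /B addrC subrK.
have dB : \det B = char_poly (u *m v) by rewrite L det_mulmx det_lblock
  det_ublock !det1 !mul1r.
have : \det (B *m block_mx ('X%:M) 0 (- U) 1%:M) = \det B * 'X.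
  by rewrite det_mulmx det_lblock det1 mulr1 det_scalar1.
rewrite dB mulmx_block !mul1mx !mulmx1 !mulmx0 !add0r mulrC => <-.
rewrite (_ : U *m _ + _ = 0); last first.
  by rewrite mul_mx_scalar mul_scalar_mx scalerN addrN.
rewrite det_ublock det_scalar; congr (_ * _).
by rewrite mulmxN -map_mxM det_mx11 !mxE eqxx mulr1n.
Qed.

(** Since (M - u v) u = 0, the characteristic matrices of M - u v and of u v
multiply to 'X times that of M; the second one has rank one. *)
Lemma char_poly_deflate (F : fieldType) n (M : 'M[F]_n) (u : 'cV[F]_n)
    (v : 'rV[F]_n) :
  M *m u = u -> v *m u = 1%:M ->
  ('X - 1) * char_poly (M - u *m v) = 'X * char_poly M.
Proof.
move=> Mu vu.
have E : char_poly_mx (M - u *m v) *m char_poly_mx (u *m v) =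
  'X *: char_poly_mx M.
  have MP : (M - u *m v) *m (u *m v) = 0.
    by rewrite mulmxBl mulmxA Mu -[u *m v *m _]mulmxA [v *m (u *m v)]mulmxA vu
      mul1mx subrr.
  rewrite /char_poly_mx mulmxBl !mulmxBr -map_mxM MP map_mx0 subr0.
  rewrite !mul_scalar_mx !mul_mx_scalar -scalerBr -scalerBr map_mxB;
    congr (_ *: _).
  by rewrite opprB addrA subrK.
have := congr1 determinant E; rewrite det_mulmx detZ -/(char_poly _)
  -/(char_poly _) -/(char_poly M) => D.
have := char_poly_rank1 u v; rewrite vu mxE eqxx mulr1n => D1.
have X0 : 'X^n != 0 :> {poly F} by rewrite monic_neq0 ?monicXn.
apply: (mulfI X0); rewrite [RHS]mulrCA -D.
rewrite [RHS]mulrCA D1 polyC1; ring.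
Qed.

Lemma rV_neq0 (R : nmodType) n (v : 'rV[R]_n) :
  v != 0 -> exists i, v 0 i != 0.
Proof.
move=> v0; apply/existsP; apply: contraNT v0 => /existsPn h.
by apply/eqP/rowP => i; rewrite mxE; apply/eqP/negPn/h.
Qed.

Lemma psdmx_eigenvalue_ge0 (R : realType) n (M : 'M[R]_n) x :
  psdmx M -> eigenvalue M x -> 0 <= x.
Proof.
case=> _ hM /eigenvalueP[v vM v0]; have := hM v^T;
  rewrite trmxK vM -scalemxAl mxE.
have [i vi] := rV_neq0 v0; rewrite pmulr_lge0 // mxE.
rewrite (bigD1 i) //= ltr_wpDr //; first by apply: sumr_ge0 => j _;
  rewrite mxE -expr2 sqr_ge0.
by rewrite mxE -expr2 exprn_even_gt0.
Qed.

Lemma stochastic_eigenvalue_le1 (R : realType) n (M : 'M[R]_n) x :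
  doubly_stochastic M -> eigenvalue M x -> x <= 1.
Proof.
case=> M0 hr hc /eigenvalueP[v vM v0].
have [i0 vi0] := rV_neq0 v0.
pose i := [arg max_(i > i0) `|v 0 i|]%O.
have imax j : `|v 0 j| <= `|v 0 i| by rewrite /i; case: arg_maxP => // k _;
  apply.
have vi : 0 < `|v 0 i| by apply: lt_le_trans (imax i0); rewrite normr_gt0.
apply: le_trans (ler_norm x) _; rewrite -(ler_pM2r vi) mul1r -normrM.
have /rowP/(_ i) := vM; rewrite !mxE => <-.
apply: le_trans (ler_norm_sum _ _ _) _; rewrite -[leRHS]mulr1 -(hc i) mulr_sumr.
by apply: ler_sum => j _; rewrite normrM [X in _ * X]ger0_norm // ler_wpM2r.
Qed.

(** The all-ones vector is an eigenvector for 1, and 1 is the largest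
eigenvalue, so it comes first in the sorted list. *)
Lemma doubly_stochastic_spectrum (R : realType) n (M : 'M[R]_n.+1)
    (lam : n.+1.-tuple R) :
  psdmx M -> doubly_stochastic M -> spectrum M lam ->
  thead lam = 1 /\ forall j, 0 <= tnth (behead_tuple lam) j.
Proof.
move=> hpsd hds [lsort hchar].
have eig x : (x \in lam) = eigenvalue M x.
  by rewrite eigenvalue_root_char hchar root_prod_XsubC.
have hM := hds; case: hM => M0 hr hc; split; last first.
  move=> j; apply: psdmx_eigenvalue_ge0 hpsd _; rewrite -eig.
  by apply: mem_behead; apply: mem_tnth.
have l1 : 1 \in (lam : seq R).
  rewrite eig; apply/eigenvalueP; exists (const_mx 1).
    rewrite scale1r; apply/rowP => j; rewrite !mxE -[RHS](hc j).
    by apply: eq_bigr => i _; rewrite mxE mul1r.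
  by apply/eqP => /rowP/(_ 0)/eqP; rewrite !mxE oner_eq0.
apply/eqP; rewrite eq_le (stochastic_eigenvalue_le1 hds) /=;
  last by rewrite -eig mem_tnth.
move: lsort l1; rewrite [in X in X -> _](tuple_eta lam)
  [in X in _ -> X -> _](tuple_eta lam) /=.
rewrite inE => /order_path_min h /predU1P[<-//|h1].
have /h/allP/(_ 1 h1) : transitive (>=%R : rel R) by move=> ? ? ? ? /le_trans;
  apply.
by [].
Qed.

(** * Gram factorisation of the deflated matrix *)

Lemma char_poly_conj (R : comNzRingType) n (P Q D : 'M[R]_n) :
  P *m Q = 1%:M -> char_poly (Q *m D *m P) = char_poly D.
Proof.
move=> PQ; have QP : Q *m P = 1%:M := mulmx1C PQ.
pose P' := map_mx polyC P; pose Q' := map_mx polyC Q.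
have E : char_poly_mx (Q *m D *m P) = Q' *m char_poly_mx D *m P'.
  rewrite /char_poly_mx mulmxBr mulmxBl -!map_mxM; congr (_ - _).
  by rewrite mul_mx_scalar -scalemxAl -map_mxM QP map_mx1 scalemx1.
rewrite /char_poly E !det_mulmx mulrAC -det_mulmx -map_mxM QP map_mx1.
by rewrite det1 mul1r.
Qed.

(** The columns of V are the unit eigenvectors of A scaled by the square roots
of their eigenvalues; dropping the eigenvector attached to the root 0 of the
characteristic polynomial leaves n columns and does not change V V^*. The
permutation s matches the eigenvalues delivered by the spectral theorem with 0,
mu_0, ..., mu_(n-1). *)
Lemma gram_of_spectrum (C : numClosedFieldType) n (A : 'M[C]_n.+1)
    (mu : 'I_n -> C) :
  A^t* = A -> (forall j, 0 <= mu j) ->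
  char_poly A = 'X * \prod_j ('X - (mu j)%:P) ->
  exists V : 'M[C]_(n.+1, n), A = V *m V^t* /\ V^t* *m V =
    diag_mx (\row_j mu j).
Proof.
move=> Aherm mu0 hchar.
have Anorm : A \is normalmx by apply/normalmxP; rewrite Aherm.
pose P := spectralmx A; pose d := spectral_diag A.
have Pu : P \is unitarymx := spectral_unitarymx A.
have PP : P *m P^t* = 1%:M by apply/unitarymxP.
have AE : A = P^t* *m diag_mx d *m P.
  by rewrite -(invmx_unitary Pu); apply/orthomx_spectralP.
have Ad : char_poly A = \prod_i ('X - (d 0 i)%:P).
  rewrite AE char_poly_conj //.
  rewrite char_poly_trig ?diag_mx_is_trig //.
  by apply: eq_bigr => i _; rewrite mxE eqxx mulr1n.
pose e := [tuple if unlift ord0 i is Some j then mu j else 0 | i < n.+1].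
pose dt := [tuple d 0 i | i < n.+1].
have /tuple_permP[s /val_inj hs] : perm_eq e dt.
  apply: prod_XsubC_eq; rewrite !big_tuple.
  under [RHS]eq_bigr do rewrite tnth_mktuple.
  rewrite -Ad hchar big_ord_recl tnth_mktuple unlift_none subr0; congr (_ * _).
  by apply: eq_bigr => j _; rewrite tnth_mktuple liftK.
have ds i : d 0 (s i) = if unlift ord0 i is Some j then mu j else 0.
  by have := congr1 (fun t => tnth t i) hs; rewrite !tnth_mktuple.
pose V := \matrix_(i < n.+1, j < n) ((P (s (lift ord0 j)) i)^* * sqrtC (mu j)).
have sK j : sqrtC (mu j) * (sqrtC (mu j))^* = mu j.
  by rewrite -normCK ger0_norm ?sqrtC_ge0 // sqrtCK.
exists V; split.
  apply/matrixP => i j; rewrite {1}AE mul_mx_diag !mxE.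
  rewrite (reindex_inj (@perm_inj _ s)) big_ord_recl /=.
  rewrite !mxE ds unlift_none mulr0 mul0r add0r; apply: eq_bigr => l _.
  by rewrite !mxE ds liftK rmorphM /= conjCK -[in LHS](sK l); ring.
apply/matrixP => j l; rewrite !mxE.
transitivity (sqrtC (mu l) * (sqrtC (mu j))^* * (P *m P^t*) (s (lift ord0 j))
  (s (lift ord0 l))).
  rewrite !mxE mulr_sumr; apply: eq_bigr => i _; rewrite !mxE rmorphM /= conjCK.
  ring.
rewrite PP mxE (inj_eq perm_inj) (inj_eq lift_inj) mulr_natr.
by case: eqVneq => [->|]; rewrite ?mulr0n // mulr1n sK.
Qed.

Lemma gram_deflated (R : realType) n (M : 'M[R]_n.+1) (lam : n.+1.-tuple R) :
  psdmx M -> doubly_stochastic M -> spectrum M lam ->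
  exists V : 'M[R[i]]_(n.+1, n),
    map_mx (real_complex R) (M - const_mx (n.+1%:R^-1)) = V *m V^t* /\
    V^t* *m V = diag_mx (\row_j (tnth (behead_tuple lam) j)%:C%C).
Proof.
move=> hpsd hds hspec; have [lam1 mu0] :=
  doubly_stochastic_spectrum hpsd hds hspec.
have [[Msym _] [_ hr hc] [_ hchar]] := And3 hpsd hds hspec.
apply: gram_of_spectrum => [|j|]; last 1 first.
- pose u : 'cV[R]_n.+1 := const_mx 1;
  pose v : 'rV[R]_n.+1 := const_mx n.+1%:R^-1.
  have n0 : n.+1%:R != 0 :> R by rewrite pnatr_eq0.
  have uv : const_mx n.+1%:R^-1 = u *m v.
    by apply/matrixP => i j; rewrite !mxE big_ord1 !mxE mul1r.
  have Mu : M *m u = u.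
    by apply/matrixP => i j; rewrite !mxE -[RHS](hr i); apply: eq_bigr => l _;
      rewrite mxE mulr1.
  have vu : v *m u = 1%:M.
    apply/matrixP => i j; rewrite !ord1 !mxE eqxx.
    under eq_bigr do rewrite !mxE mulr1.
    by rewrite sumr_const card_ord -[LHS]mulr_natl divff.
  have lamE : \prod_(x <- lam) ('X - x%:P) =
    ('X - 1) * \prod_(x <- behead lam) ('X - x%:P).
    by rewrite {1}(tuple_eta lam) big_cons lam1 polyC1.
  have := char_poly_deflate Mu vu; rewrite -uv hchar lamE mulrCA.
  have X1 : 'X - 1 != 0 :> {poly R} by rewrite -polyC1 polyXsubC_eq0.
  move/(mulfI X1) => hA; rewrite -map_char_poly hA rmorphM /= map_polyX;
    congr (_ * _).
  rewrite rmorph_prod (big_tuple _ _ (behead_tuple lam)) /=;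
    apply: eq_bigr => j _.
  by rewrite rmorphB /= map_polyX map_polyC.
- apply/matrixP => i j; rewrite !mxE.
  rewrite (_ : Num.conj _ = (M j i - n.+1%:R^-1)%:C%C); last exact: conjc_real.
  by rewrite -[in LHS]Msym mxE.
- by rewrite ler0c.
Qed.

Lemma norm2_gram (C : numClosedFieldType) n m (V : 'M[C]_(n, m))
    (mu : 'I_m -> C) (g : 'cV[C]_m) :
  V^t* *m V = diag_mx (\row_j mu j) ->
  \sum_i `|(V *m g) i 0| ^+ 2 = \sum_j mu j * `|g j 0| ^+ 2.
Proof.
move=> hV; transitivity (((V *m g)^t* *m (V *m g)) 0 0).
  by rewrite mxE; apply: eq_bigr => i _; rewrite !mxE normCK mulrC.
rewrite trmx_mul map_mxM mulmxA -[_ *m V^t* *m V]mulmxA hV mul_mx_diag mxE.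
by apply: eq_bigr => j _; rewrite !mxE normCK; ring.
Qed.

Lemma frobenius_gram (C : numClosedFieldType) n m (V : 'M[C]_(n, m))
    (mu : 'I_m -> C) :
  V^t* *m V = diag_mx (\row_j mu j) ->
  \sum_i \sum_j `|(V *m V^t*) i j| ^+ 2 = \sum_j mu j ^+ 2.
Proof.
move=> hV; pose A := V *m V^t*.
have Ah : A^t* = A by rewrite /A trmx_mul map_mxM /= trmxCK.
transitivity (\tr (A *m A)).
  apply: eq_bigr => i _; rewrite [RHS]mxE; apply: eq_bigr => j _.
  rewrite normCK -/A; congr (_ * _).
  have : A^t* j i = A j i by rewrite Ah.
  by move <-; rewrite [RHS]mxE [in RHS]mxE.
rewrite /A mulmxA -[_ *m V^t* *m V]mulmxA hV mxtrace_mulC mulmxA hV mul_diag_mx.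
by apply: eq_bigr => j _; rewrite !mxE eqxx mulr1n expr2.
Qed.

(** The squared norm of the vector of column sums of V is the sum of all
entries of its Gram matrix. *)
Lemma gram_sum0 (C : numClosedFieldType) n m (V : 'M[C]_(n, m)) :
  (forall j, \sum_i (V *m V^t*) i j = 0) -> forall j, \sum_i V i j = 0.
Proof.
move=> hA j; pose u : 'rV[C]_n := const_mx 1.
have uA : u *m (V *m V^t*) = 0.
  by apply/rowP => i; rewrite !mxE -[RHS](hA i); apply: eq_bigr => l _;
    rewrite [u _ _]mxE mul1r.
have : ((u *m V) *m (u *m V)^t*) 0 0 = 0.
  by rewrite trmx_mul map_mxM !mulmxA -[u *m V *m _]mulmxA uA mul0mx mxE.
rewrite mxE => /eqP; rewrite psumr_eq0 => [|l _];
  last by rewrite !mxE -normCK exprn_ge0.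
move=> /allP/(_ j (mem_index_enum j));
  rewrite !mxE -normCK sqrf_eq0 normr_eq0 => /eqP h.
by rewrite -[RHS]h; apply: eq_bigr => i _; rewrite mxE mul1r.
Qed.

(** * Homogeneity and the two bounds *)

Lemma vec_eZ (R : comNzRingType) n k (a : R) (z : 'rV[R]_n) :
  vec_e k (a *: z) = a ^+ k * vec_e k z.
Proof.
rewrite /vec_e mulr_sumr; apply: eq_bigr => S /eqP <-.
rewrite -prodr_const -big_split; apply: eq_bigr => i _ /=.
by rewrite mxE.
Qed.

Lemma mx_eZ (F : fieldType) n k (a : F) (A : 'M[F]_n) :
  mx_e k (a *: A) = a ^+ k * mx_e k A.
Proof.
rewrite /mx_e mulrCA; congr (_ * _); rewrite mulr_sumr; apply: eq_bigr => S _.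
rewrite mulr_sumr; apply: eq_bigr => T _; rewrite /Perm mulr_sumr;
  apply: eq_bigr => s _.
rewrite -[X in a ^+ X]card_ord -prodr_const -big_split.
by apply: eq_bigr => i _ /=; rewrite !mxE.
Qed.

(** Homogeneous form of the property of c, obtained by scaling z to squared
norm n. When z = 0 both sides vanish, as k >= 1. *)
Lemma vec_e_bound (R : realType) (c : R) n k (z : 'rV[R[i]%C]_n) :
  vec_e_const c -> (1 <= k <= n)%N -> \sum_i z 0 i = 0 ->
  `|vec_e k z| ^+ 2 <= (c * 'C(n, k)%:R / n%:R ^+ k)%:C%C *
    (\sum_i `|z 0 i| ^+ 2) ^+ k.
Proof.
case=> c0 hc /andP[k0 kn] z0.
have n0 : (0 < n)%N by apply: leq_trans kn.
have nC : 0 < n%:R :> R[i]%C by rewrite ltr0n.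
set s := \sum_i `|z 0 i| ^+ 2.
have s_ge0 : 0 <= s by apply: sumr_ge0 => i _; rewrite exprn_ge0.
have [s0|sn0] := eqVneq s 0.
  have zE : z = 0 *: z.
    rewrite scale0r; apply/rowP => i; rewrite mxE.
    move/eqP: s0; rewrite psumr_eq0 => [/allP/(_ i (mem_index_enum i))|j _];
      last by rewrite exprn_ge0.
    by rewrite sqrf_eq0 normr_eq0 => /eqP.
  have e0 : 0 ^+ k = 0 :> R[i]%C by rewrite expr0n gtn_eqF.
  by rewrite zE vec_eZ s0 e0 mul0r normr0 expr0n mulr0.
have s_gt0 : 0 < s by rewrite lt_def sn0.
pose r := sqrtC (n%:R / s).
have r_gt0 : 0 < r by rewrite sqrtC_gt0 divr_gt0.
have r2 : r ^+ 2 = n%:R / s by rewrite sqrtCK.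
have h1 : \sum_i (r *: z) 0 i = 0.
  by under eq_bigr do rewrite mxE; rewrite -mulr_sumr z0 mulr0.
have h2 : \sum_i `|(r *: z) 0 i| ^+ 2 = n%:R.
  under eq_bigr do rewrite mxE normrM exprMn (gtr0_norm r_gt0).
  by rewrite -mulr_sumr r2 divfK.
have := hc n k (r *: z) n0 kn h1 h2;
  rewrite vec_eZ normrM (gtr0_norm (exprn_gt0 _ r_gt0)) => h.
have cb0 : 0 <= c * 'C(n, k)%:R by rewrite mulr_ge0 // ltW.
have : (r ^+ k * `|vec_e k z|) ^+ 2 <= ((Num.sqrt (c * 'C(n, k)%:R))%:C%C) ^+ 2.
  by rewrite ler_pXn2r // nnegrE ?mulr_ge0 ?exprn_ge0 ?(ltW r_gt0) // ler0c
    sqrtr_ge0.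
rewrite -(rmorphXn (real_complex R)) sqr_sqrtr // exprMn exprAC r2 expr_div_n
  => h3.
rewrite rmorphM /= fmorphV rmorphXn rmorph_nat -mulrA.
have -> : `|vec_e k z| ^+ 2 = (n%:R ^+ k / s ^+ k * `|vec_e k z| ^+ 2) *
  (n%:R ^- k * s ^+ k).
  by field; rewrite !expf_neq0 // gt_eqF.
by rewrite ler_wpM2r // mulr_ge0 ?invr_ge0 ?exprn_ge0 // ltW.
Qed.

(** Homogeneous form of the property of b, obtained by scaling A to Frobenius
norm n. *)
Lemma mx_e_bound (R : realType) (b : R) n k (A : 'M[R[i]%C]_n) :
  mx_e_const b -> (1 <= k <= n)%N ->
  (forall i, \sum_j A i j = 0) -> (forall j, \sum_i A i j = 0) ->
  n%:R ^+ k * `|mx_e k A| <= (b ^+ k * 'C(n, k)%:R)%:C%C *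
    frobenius_norm A ^+ k.
Proof.
case=> b0 hb hk hr hc; have [k0 kn] := andP hk.
have n0 : (0 < n)%N by apply: leq_trans kn.
have nC : 0 < n%:R :> R[i]%C by rewrite ltr0n.
set s := frobenius_norm A.
have sum_ge0 : 0 <= \sum_i \sum_j `|A i j| ^+ 2.
  by apply: sumr_ge0 => i _; apply: sumr_ge0 => j _; rewrite exprn_ge0.
have s_ge0 : 0 <= s by rewrite sqrtC_ge0.
have [s0|sn0] := eqVneq s 0.
  have AE : A = 0 *: A.
    rewrite scale0r; apply/matrixP => i j; rewrite mxE.
    move/eqP: s0; rewrite sqrtC_eq0 psumr_eq0
      => [/allP/(_ i (mem_index_enum i))|l _]; last first.
      by apply: sumr_ge0 => ? _; rewrite exprn_ge0.
    rewrite psumr_eq0 => [/allP/(_ j (mem_index_enum j))|l _];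
      last by rewrite exprn_ge0.
    by rewrite sqrf_eq0 normr_eq0 => /eqP.
  have e0 : 0 ^+ k = 0 :> R[i]%C by rewrite expr0n gtn_eqF.
  by rewrite AE mx_eZ s0 e0 mul0r normr0 !mulr0.
have s_gt0 : 0 < s by rewrite lt_def sn0.
pose r := n%:R / s.
have r_gt0 : 0 < r by rewrite divr_gt0.
have h1 i : \sum_j (r *: A) i j = 0.
  by under eq_bigr do rewrite mxE; rewrite -mulr_sumr hr mulr0.
have h2 j : \sum_i (r *: A) i j = 0.
  by under eq_bigr do rewrite mxE; rewrite -mulr_sumr hc mulr0.
have h3 : frobenius_norm (r *: A) = n%:R.
  rewrite /frobenius_norm.
  under eq_bigr do under eq_bigr do rewrite mxE normrM exprMn (gtr0_norm r_gt0).
  under eq_bigr do rewrite -mulr_sumr.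
  rewrite -mulr_sumr -(sqrtCK (\sum_i _)) -exprMn -/(frobenius_norm A) -/s
    divfK //.
  by rewrite sqrCK // ltW.
have := hb n k (r *: A) n0 hk h1 h2 h3;
  rewrite mx_eZ normrM (gtr0_norm (exprn_gt0 _ r_gt0)) expr_div_n => h.
have -> : n%:R ^+ k * `|mx_e k A| = n%:R ^+ k / s ^+ k * `|mx_e k A| * s ^+ k.
  by field; rewrite expf_neq0.
by rewrite ler_wpM2r // exprn_ge0.
Qed.

Lemma Perm_map (R S : comNzRingType) (f : {rmorphism R -> S}) m (D : 'M[R]_m) :
  Perm (map_mx f D) = f (Perm D).
Proof.
rewrite /Perm rmorph_sum; apply: eq_bigr => s _; rewrite rmorph_prod.
by apply: eq_bigr => i _; rewrite mxE.
Qed.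

Lemma sum_Perm_map (R S : comNzRingType) (f : {rmorphism R -> S}) n k
    (A : 'M[R]_n) :
  \sum_(S0 : ksubset n k) \sum_(T : ksubset n k) Perm
    (submx_of (map_mx f A) S0 T) =
  f (\sum_(S0 : ksubset n k) \sum_(T : ksubset n k) Perm (submx_of A S0 T)).
Proof.
rewrite rmorph_sum; apply: eq_bigr => S0 _; rewrite rmorph_sum;
  apply: eq_bigr => T _.
by rewrite -Perm_map; congr Perm; apply/matrixP => i j; rewrite !mxE.
Qed.

Lemma Perm_deflated (R : realType) n (M : 'M[R]_n) :
  (0 < n)%N -> doubly_stochastic M ->
  n%:R ^+ n / n`!%:R * Perm M - 1 =
  \sum_(2 <= k < n.+1) n%:R ^+ k / 'C(n, k)%:R * mx_e k (M - const_mx n%:R^-1).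
Proof.
move=> n0 [_ hr _]; set A := M - _.
have nR : n%:R != 0 :> R by rewrite pnatr_eq0 -lt0n.
have E k : (k <= n)%N -> n%:R ^+ n / n`!%:R *
  (((n - k)`!)%:R * n%:R^-1 ^+ (n - k) *
    \sum_(S : ksubset n k) \sum_(T : ksubset n k) Perm (submx_of A S T)) =
    n%:R ^+ k / 'C(n, k)%:R * mx_e k A :> R.
  move=> kn; rewrite /mx_e.
  have -> : n%:R ^+ n = n%:R ^+ (n - k) *
    n%:R ^+ k :> R by rewrite -exprD subnK.
  rewrite -(bin_fact kn) !natrM exprVn.
  have H0 : 'C(n, k)%:R != 0 :> R by rewrite pnatr_eq0 -lt0n bin_gt0.
  have Hf j : j`!%:R != 0 :> R by rewrite pnatr_eq0 -lt0n fact_gt0.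
  have H j : n%:R ^+ j != 0 :> R by rewrite expf_neq0.
  have h1 : (n - k)`!%:R != 0 :> R by [].
  have h2 : k`!%:R != 0 :> R by [].
  move: (\sum_(S : _) _) (n%:R ^+ (n - k)) (H (n - k)%N) (n%:R ^+ k)
    ('C(n, k)%:R) H0 h1 h2.
  by move=> Q x x0 y z z0 h1 h2; field; rewrite h1 h2 x0 z0.
have -> : M = A + const_mx n%:R^-1 by rewrite subrK.
rewrite Perm_add_const -(big_mkord xpredT
  (fun k => ((n - k)`!)%:R * n%:R^-1 ^+ (n - k) *
    \sum_(S : ksubset n k) \sum_(T : ksubset n k) Perm (submx_of A S T))).
rewrite mulr_sumr big_ltn // big_ltn // !E //.
have A0 i : \sum_j A i j = 0.
  under eq_bigr do rewrite !mxE.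
  by rewrite sumrB hr sumr_const card_ord -[X in _ - X]mulr_natl divff // subrr.
rewrite [mx_e 1 A]/mx_e sum_Perm1_eq0 // !mulr0 add0r.
have -> : n%:R ^+ 0 / 'C(n, 0)%:R * mx_e 0 A = 1.
  rewrite expr0 bin0 divr1 mul1r /mx_e fact0 invr1 mul1r.
  have one : \sum_(S : ksubset n 0) (1 : R) = 1.
    by rewrite -(sum_ksubset 0%N (fun=> 1)) (big_pred1 set0) // => S;
      rewrite cards_eq0.
  rewrite -[RHS]one; apply: eq_bigr => S _; rewrite -[RHS]one;
    apply: eq_bigr => T _.
  rewrite /Perm (eq_bigr (fun=> 1)) => [|s _]; last by rewrite big_ord0.
  by rewrite sumr_const card_Sn.
rewrite addrAC subrr add0r; rewrite big_nat_cond [RHS]big_nat_cond;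
  apply: eq_bigr => k.
by rewrite andbT ltnS => /andP[_ kn]; rewrite E.
Qed.

(** The constants concern complex vectors and matrices, so the deflated matrix
A is embedded in the complex numbers, where it factors as V V^*. The first
bound is fischer_bound for K = C binom(n,k)/n^k, the second one is mx_e_bound
with the Frobenius norm read off from the eigenvalues. *)
Lemma deflated_bounds (R : realType) (C B : R) n k (M : 'M[R]_n.+1)
    (lam : n.+1.-tuple R) :
  vec_e_const C -> mx_e_const B ->
  psdmx M -> doubly_stochastic M -> spectrum M lam ->
  (1 <= k <= n.+1)%N ->
  n.+1%:R ^+ k / 'C(n.+1, k)%:R * mx_e k (M - const_mx n.+1%:R^-1) <=
    Num.min (C * complete_sym k (behead_tuple lam))
            (B ^+ k * powR (\sum_(x <- behead lam) x ^+ 2) (k%:R / 2)).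
Proof.
move=> hC hB hpsd hds hspec hk.
have [_ mu0] := doubly_stochastic_spectrum hpsd hds hspec.
have [V [hV hVV]] := gram_deflated hpsd hds hspec.
have [_ hr hc] := hds; have /andP[k0 kn] := hk.
set A := M - _ in hV *; set mu := tnth (behead_tuple lam) in hVV mu0.
have nR : n.+1%:R != 0 :> R by rewrite pnatr_eq0.
have N : n.+1%:R^-1 *+ n.+1 = 1 :> R by rewrite -[LHS]mulr_natl divff.
have Ar i : \sum_j A i j = 0.
  by under eq_bigr do rewrite !mxE;
    rewrite sumrB hr sumr_const card_ord N subrr.
have Ac j : \sum_i A i j = 0.
  by under eq_bigr do rewrite !mxE;
    rewrite sumrB hc sumr_const card_ord N subrr.
have Ar' i : \sum_j map_mx (real_complex R) A i j = 0.
  by under eq_bigr do rewrite mxE; rewrite -rmorph_sum Ar.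
have Ac' j : \sum_i map_mx (real_complex R) A i j = 0.
  by under eq_bigr do rewrite mxE; rewrite -rmorph_sum Ac.
have bin_gt : 0 < 'C(n.+1, k)%:R :> R by rewrite ltr0n bin_gt0.
have V0 : forall j, \sum_i V i j = 0 by apply: gram_sum0; rewrite -hV.
pose K := C * 'C(n.+1, k)%:R / n.+1%:R ^+ k.
rewrite le_min; apply/andP; split.
  have K0 : 0 <= K by rewrite divr_ge0 ?exprn_ge0 // mulr_ge0 // ltW //;
    case: hC.
  have := @fischer_bound R _ _ k V mu K K0 mu0;
    rewrite -hV sum_Perm_map /= => h.
  rewrite /mx_e -/(complete_sym k (behead_tuple lam)).
  have k1 : 0 < k`!%:R :> R by rewrite ltr0n fact_gt0.
  have nk : 0 < n.+1%:R ^+ k :> R by rewrite exprn_gt0 // ltr0n.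
  have -> : C * complete_sym k (behead_tuple lam) =
    n.+1%:R ^+ k / 'C(n.+1, k)%:R *
     (k`!%:R^-1 * (K * (k`!%:R * complete_sym k (behead_tuple lam)))).
    by rewrite /K; field; rewrite !gt_eqF.
  rewrite ler_wpM2l ?divr_ge0 ?(ltW nk) ?(ltW bin_gt) // ler_wpM2l ?invr_ge0
    ?(ltW k1) //.
  apply: h => g; apply: le_trans (vec_e_bound hC hk _) _.
    under eq_bigr do rewrite !mxE; rewrite exchange_big big1 // => j _.
    by rewrite -mulr_suml V0 mul0r.
  rewrite -(norm2_gram g hVV) (eq_bigr (fun i => `|(V *m g) i 0| ^+ 2)) // => i
    _.
  by rewrite mxE.
have := mx_e_bound hB hk Ar' Ac'; set F := frobenius_norm _ => h.
have sq_ge0 : 0 <= \sum_(x <- behead lam) x ^+ 2 by apply: sumr_ge0 => x _;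
  rewrite sqr_ge0.
have FE : F = (Num.sqrt (\sum_(x <- behead lam) x ^+ 2))%:C%C.
  rewrite /F /frobenius_norm hV (frobenius_gram hVV).
  rewrite -[in RHS]/(tval (behead_tuple lam)) big_tuple.
  apply/eqP; rewrite -(@eqrXn2 _ 2) ?sqrtC_ge0 ?ler0c ?sqrtr_ge0 //; last first.
    by apply: sumr_ge0 => j _; rewrite exprn_ge0 // ler0c.
  rewrite sqrtCK -(rmorphXn (real_complex R)) sqr_sqrtr; last first.
    by apply: sumr_ge0 => j _; rewrite sqr_ge0.
  by rewrite rmorph_sum; apply/eqP; apply: eq_bigr => j _; rewrite rmorphXn.
have mxE' : mx_e k (map_mx (real_complex R) A) = (mx_e k A)%:C%C.
  by rewrite /mx_e sum_Perm_map rmorphM fmorphV rmorph_nat.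
have powE : powR (\sum_(x <- behead lam) x ^+ 2) (k%:R / 2) =
  Num.sqrt (\sum_(x <- behead lam) x ^+ 2) ^+ k.
  by rewrite mulrC powRrM powR12_sqrt // powR_mulrn // sqrtr_ge0.
rewrite powE; set s := Num.sqrt _ in FE *.
move: h; rewrite FE mxE' => h.
have {}h : n.+1%:R ^+ k * mx_e k A <= B ^+ k * 'C(n.+1, k)%:R * s ^+ k.
  rewrite -lecR; apply: le_trans (_ : n.+1%:R ^+ k * `|(mx_e k A)%:C%C| <= _).
    rewrite rmorphM rmorphXn rmorph_nat ler_wpM2l ?exprn_ge0 //.
    by rewrite real_ler_norm // complex_real.
  by apply: le_trans h _; rewrite [leRHS]rmorphM rmorphXn.
rewrite mulrAC ler_pdivrMr //; apply: le_trans h _.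
by rewrite mulrAC.
Qed.

Theorem corollary1p3 (R : realType) (C B : R)
    (hC : vec_e_const C) (hB : mx_e_const B)
    (n : nat) (hn : (1 <= n)%N) (M : 'M[R]_n)
    (hpsd : psdmx M) (hds : doubly_stochastic M)
    (lam : n.-tuple R) (hlam : spectrum M lam) :
  n%:R ^+ n / n`!%:R * Perm M - 1 <=
  \sum_(2 <= k < n.+1)
    Num.min (C * complete_sym k (behead_tuple lam))
            (B ^+ k * powR (\sum_(x <- behead lam) x ^+ 2) (k%:R / 2)).
Proof.
case: n hn M hpsd hds lam hlam => // n _ M hpsd hds lam hlam.
rewrite Perm_deflated //; apply: ler_sum_nat => k /andP[k2 kn].
by apply: deflated_bounds; rewrite // (ltnW k2).
Qed.
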